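(* Let $M\subset\mathbb{R}^{d+1}$ be a smooth compact $d$-dimensional Riemannian hypersurface (with the induced metric), fix $x\in M$ and a unit normal vector $\mathbf{n}$ to $T_xM$, and for each unit tangent vector $v\in UT_xM$ define $\kappa_v(x)$ by $\gamma_v''(0)=\kappa_v(x)\mathbf{n}$, where $\gamma_v(s)=\exp_x(sv)$. Let $\kappa_1(x)=\inf_{v\in UT_xM}\kappa_v(x)$ and $\kappa_2(x)=\sup_{v\in UT_xM}\kappa_v(x)$. Fix any $\kappa_0\in[\kappa_1(x),\kappa_2(x)]$ with $\kappa_0\neq0$, and let $S_x(c,r)$ be the sphere in $\mathbb{R}^{d+1}$ with center $c=x+\frac{1}{\kappa_0}\mathbf{n}$ and radius $r=\frac{1}{|\kappa_0|}$, with associated spherical distance $d_S$ (defined in the context). Let $\bar r>0$ be (sufficiently small) and let $y=\exp_x(sv)\in B_{\bar r}(x)$, $v\in UT_xM$, be such that $d_M(x,y)=s$; put $\kappa_y=\kappa_v(x)$. Then: (1) If $\kappa_y=\kappa_0$ or $\kappa_y=2\kappa_0$, then $d_S(x,y)=s+O(s^4)$. (2) If $|\kappa_2(x)-\kappa_1(x)|<\bar r$, then $d_S(x,y)=s+O(\bar r s^3)$.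
   Context: $d_M$ is the geodesic distance on $M$, $\exp_x$ the Riemannian exponential map, $UT_xM$ the set of unit vectors in $T_xM$, and $B_{\bar r}(x)$ the geodesic ball on $M$ centered at $x$ with radius $\bar r$. The projection $\pi:M\to S_x(c,r)$ is $\pi(z)=c+r\,\frac{z-c}{\|z-c\|}$ (defined for $z\ne c$, in particular near $x$). The spherical distance is $$d_S(x,y)=r\arccos\left\{\frac{\pi(x)-c}{r}\cdot\frac{\pi(y)-c}{r}\right\},$$ i.e. the geodesic distance on the sphere $S_x(c,r)$ between $\pi(x)=x$ and $\pi(y)$. In (1), $O(s^4)$ is as $s\to0$. In (2), $O(\bar r s^3)$ denotes a quantity bounded in absolute value by $C\bar r s^3$ with $C$ independent of $y$, $s$ and $\bar r$ ($M$, $x$, $\kappa_0$ fixed, $\bar r$ small). *)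

(* Defs.v *)
From HB Require Import structures.
From mathcomp Require Import all_boot all_order all_algebra.
From mathcomp Require Import all_classical all_reals all_analysis.

Set Implicit Arguments.
Unset Strict Implicit.
Unset Printing Implicit Defensive.

Import Order.TTheory GRing.Theory Num.Theory.
Import numFieldNormedType.Exports.

Local Open Scope classical_set_scope.
Local Open Scope ring_scope.

(* The library's norm `|u| on row vectors is the sup norm: it induces the usual
   topology and derivatives, but lengths and angles must use [enorm]. *)
Definition dotv {R : realType} {n : nat} (u v : 'rV[R]_n) : R :=
  \sum_(i < n) u 0 i * v 0 i.

Definition enorm {R : realType} {n : nat} (u : 'rV[R]_n) : R :=
  Num.sqrt (dotv u u).

(* C^{k+1} on U: differentiable on U with all directional derivatives C^k. *)
Fixpoint Ck_on {R : realType} {n : nat} (k : nat) (U : set 'rV[R]_n.+1)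
    (f : 'rV[R]_n.+1 -> R) : Prop :=
  match k with
  | 0%N => forall z, U z -> {for z, continuous f}
  | k'.+1 => (forall z, U z -> differentiable f z) /\
             (forall v : 'rV[R]_n.+1, Ck_on k' U (fun z => 'd f z v))
  end.

Definition smooth_on {R : realType} {n : nat} (U : set 'rV[R]_n.+1)
    (f : 'rV[R]_n.+1 -> R) : Prop :=
  forall k : nat, Ck_on k U f.

Definition smooth_curve {R : realType} {n : nat} (g : R -> 'rV[R]_n.+1) : Prop :=
  forall (k : nat) (t : R), derivable (derive1n k g) t 1.

Definition local_defining_function {R : realType} {d : nat}
    (M U : set 'rV[R]_d.+1) (f : 'rV[R]_d.+1 -> R) : Prop :=
  [/\ open U,
      smooth_on U f,
      (forall z, U z -> exists v : 'rV[R]_d.+1, 'd f z v != 0)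
    & M `&` U = [set z | U z /\ f z = 0]].

(* Embedded smooth hypersurface of R^{d+1}, of dimension d. *)
Definition smooth_hypersurface {R : realType} {d : nat}
    (M : set 'rV[R]_d.+1) : Prop :=
  forall p, M p ->
    exists (U : set 'rV[R]_d.+1) (f : 'rV[R]_d.+1 -> R),
      U p /\ local_defining_function M U f.

(* T_pM = ker df_p; the kernel is the same for all local defining functions. *)
Definition tangent_space {R : realType} {d : nat}
    (M : set 'rV[R]_d.+1) (p : 'rV[R]_d.+1) : set 'rV[R]_d.+1 :=
  [set v | exists (U : set 'rV[R]_d.+1) (f : 'rV[R]_d.+1 -> R),
      [/\ U p, local_defining_function M U f & 'd f p v = 0]].

Definition unit_tangent {R : realType} {d : nat}
    (M : set 'rV[R]_d.+1) (p : 'rV[R]_d.+1) : set 'rV[R]_d.+1 :=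
  [set v | tangent_space M p v /\ enorm v = 1].

Definition unit_normal {R : realType} {d : nat}
    (M : set 'rV[R]_d.+1) (p n : 'rV[R]_d.+1) : Prop :=
  enorm n = 1 /\ forall v, tangent_space M p v -> dotv n v = 0.

(* For the induced metric the covariant derivative of a velocity field is the
   tangential part of the acceleration in R^{d+1}. *)
Definition geodesic {R : realType} {d : nat} (M : set 'rV[R]_d.+1)
    (g : R -> 'rV[R]_d.+1) : Prop :=
  [/\ smooth_curve g,
      (forall t, M (g t))
    & (forall t w, tangent_space M (g t) w -> dotv (derive1n 2 g t) w = 0)].

(* [e] is exp_p on T_pM (its values off T_pM are irrelevant): for v in T_pM,
   t |-> exp_p(tv) is the complete geodesic with initial point p and initial
   velocity v. On a compact hypersurface such an [e] exists and is unique on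
   T_pM, by the theory of ordinary differential equations. *)
Definition is_exponential_map {R : realType} {d : nat} (M : set 'rV[R]_d.+1)
    (p : 'rV[R]_d.+1) (e : 'rV[R]_d.+1 -> 'rV[R]_d.+1) : Prop :=
  forall v, tangent_space M p v ->
    exists g : R -> 'rV[R]_d.+1,
      [/\ geodesic M g, g 0 = p, derive1 g 0 = v & forall t, e (t *: v) = g t].

(* Piecewise smooth curves [0,1] -> M from p to q; each piece is smooth up to
   its endpoints, that is, it extends to a smooth curve. *)
Definition admissible_curve {R : realType} {d : nat} (M : set 'rV[R]_d.+1)
    (p q : 'rV[R]_d.+1) (g : R -> 'rV[R]_d.+1) : Prop :=
  [/\ g 0 = p, g 1 = q,
      (forall t, 0 <= t <= 1 -> M (g t))
    & exists2 ts : seq R, itv_partition 0 1 ts &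
        forall i : nat, (i < size ts)%N ->
          exists2 h : R -> 'rV[R]_d.+1, smooth_curve h &
            forall t, nth 1 (0 :: ts) i <= t <= nth 1 (0 :: ts) i.+1 ->
              g t = h t].

(* The derivative may be a junk value at the finitely many break points, a
   Lebesgue-null set. *)
Definition curve_length {R : realType} {d : nat}
    (g : R -> 'rV[R]_d.+1) : \bar R :=
  (\int[lebesgue_measure]_(t in `[0%R, 1%R]) (enorm (derive1 g t))%:E)%E.

(* Equal to +oo between distinct connected components. *)
Definition geodesic_dist {R : realType} {d : nat} (M : set 'rV[R]_d.+1)
    (p q : 'rV[R]_d.+1) : \bar R :=
  ereal_inf [set curve_length g | g in admissible_curve M p q].

Definition geodesic_ball {R : realType} {d : nat} (M : set 'rV[R]_d.+1)
    (p : 'rV[R]_d.+1) (rho : R) : set 'rV[R]_d.+1 :=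
  [set q | M q /\ (geodesic_dist M p q < rho%:E)%E].

(* For v in UT_xM: the k with (d/ds)^2 exp_x(sv) = k n at s = 0, where [e] is
   exp_x and [n] the chosen unit normal; it is unique since n != 0. *)
Definition normal_curvature {R : realType} {d : nat}
    (e : 'rV[R]_d.+1 -> 'rV[R]_d.+1) (n v : 'rV[R]_d.+1) : R :=
  get [set k : R | derive1n 2 (fun s : R => e (s *: v)) 0 = k *: n].

Definition kappa_min {R : realType} {d : nat} (M : set 'rV[R]_d.+1)
    (x : 'rV[R]_d.+1) (e : 'rV[R]_d.+1 -> 'rV[R]_d.+1) (n : 'rV[R]_d.+1) : R :=
  inf [set normal_curvature e n v | v in unit_tangent M x].

Definition kappa_max {R : realType} {d : nat} (M : set 'rV[R]_d.+1)
    (x : 'rV[R]_d.+1) (e : 'rV[R]_d.+1 -> 'rV[R]_d.+1) (n : 'rV[R]_d.+1) : R :=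
  sup [set normal_curvature e n v | v in unit_tangent M x].

Definition sphere_proj {R : realType} {d : nat} (c : 'rV[R]_d.+1) (r : R)
    (z : 'rV[R]_d.+1) : 'rV[R]_d.+1 :=
  c + r *: ((enorm (z - c))^-1 *: (z - c)).

Definition sphere_dist {R : realType} {d : nat} (c : 'rV[R]_d.+1) (r : R)
    (p q : 'rV[R]_d.+1) : R :=
  r * acos (dotv (r^-1 *: (sphere_proj c r p - c))
                 (r^-1 *: (sphere_proj c r q - c))).

(* Main.v *)
Require Import Defs.
From mathcomp Require Import all_boot all_order all_algebra.
From mathcomp Require Import all_classical all_reals all_analysis.
From mathcomp Require Import ring lra.

Set Implicit Arguments.
Unset Strict Implicit.
Unset Printing Implicit Defensive.

Import Order.TTheory GRing.Theory Num.Theory.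
Import numFieldNormedType.Exports.

Local Open Scope classical_set_scope.
Local Open Scope ring_scope.

(** The geodesic t |-> exp_x(tv) is compared with the sphere by a Taylor expansion
at t = 0 whose error is uniform in the unit tangent vector v.

Let g be a unit-speed geodesic from x and kappa its normal curvature at x. If M is
locally { f = 0 }, then g'' is normal to ker df, and differentiating df(g') = 0 gives
g'' = - (D^2 f(g', g') / |grad f|^2) grad f along g ([geodesic_equation]). All
quantities on the right are bounded and Lipschitz at t = 0, with constants that do
not depend on g, so g''(t) = kappa n + O(t) uniformly ([unif_lip0_acceleration]).
Integrating, and using |g'| = 1 and g'' . g' = 0, one finds

  n . (g - x) = kappa t^2 / 2 + O(t^3)            ([normal_expansion]),
  |g - x|^2   = t^2 - kappa^2 t^4 / 12 + O(t^5)   ([chord_expansion]).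

These two numbers determine the angle theta at the centre of the sphere between x and
g(t), and d_S = theta / |kappa0|. They enter through the polynomial identity of
[sphere_dist_angle] for sin^2 theta. Comparing with sin^2 tau for
tau = |kappa0| (t + A t^3) shows that

  d_S(x, g(t)) = t + A t^3 + O(t^4),   A = - (kappa - kappa0) (kappa - 2 kappa0) / 6

([sphere_dist_expansion]). In case (1) the coefficient A vanishes. In case (2) both
kappa and kappa0 lie in [kappa_1, kappa_2], so |kappa - kappa0| < rbar and A is
O(rbar), while O(s^4) is O(rbar s^3) because s < rbar. The distance on M enters only
through s >= 0 and the upper bound on s that membership in the ball gives.

The constant in (2) serves every rbar: beyond the range of the expansion, d_S is at
most half a great circle, and s^4 is bounded below. *)

(** * Uniform orders of magnitude *)

(** The estimates must hold with constants independent of the direction of the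
   geodesic, so everything is stated for a family of functions of t indexed by
   V, with one s0 and one constant for the whole family. The endpoint t = 0 is
   included, which makes initial values part of the family. *)
Definition uniformly_near0 {R : realType} {I : Type} (V : set I)
    (P : I -> R -> Prop) : Prop :=
  exists2 s0, 0 < s0 & forall v t, V v -> 0 <= t <= s0 -> P v t.

Definition unifO {R : realType} {I : Type} (V : set I) (k : nat)
    (h : I -> R -> R) : Prop :=
  exists B, uniformly_near0 V (fun v t => `|h v t| <= B * t ^+ k).

Lemma uniformly_near0_imply {R : realType} {I : Type} (V : set I)
    (P Q : I -> R -> Prop) :
  (forall v t, V v -> 0 <= t -> P v t -> Q v t) ->
  uniformly_near0 V P -> uniformly_near0 V Q.
Proof.
move=> PQ [s0 s0_gt0 hP]; exists s0 => // v t Vv ht.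
by apply: PQ => //; [case/andP: ht | exact: hP].
Qed.

Lemma uniformly_near0_and {R : realType} {I : Type} (V : set I)
    (P Q : I -> R -> Prop) :
  uniformly_near0 V P -> uniformly_near0 V Q ->
  uniformly_near0 V (fun v t => P v t /\ Q v t).
Proof.
move=> [s s_gt0 hP] [s' s'_gt0 hQ]; exists (Num.min s s').
  by rewrite lt_min s_gt0.
move=> v t Vv /andP[t_ge0]; rewrite le_min => /andP[ts ts'].
by split; [apply: hP | apply: hQ] => //; apply/andP.
Qed.

Lemma uniformly_near0_le {R : realType} {I : Type} (V : set I) (e : R) :
  0 < e -> uniformly_near0 V (fun _ t => t <= e).
Proof. by move=> e_gt0; exists e => // v t _ /andP[]. Qed.

(** A bound near 0 is inherited by the whole segment [0, t], which is what
   the mean value theorem needs. *)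
Lemma uniformly_near0_segment {R : realType} {I : Type} (V : set I)
    (P : I -> R -> Prop) :
  uniformly_near0 V P ->
  uniformly_near0 V (fun v t => forall u, 0 <= u <= t -> P v u).
Proof.
move=> [s0 s0_gt0 hP]; exists s0 => // v t Vv /andP[_ ts] u /andP[u_ge0 ut].
by apply: hP => //; rewrite u_ge0 (le_trans ut).
Qed.

Lemma uniformly_near0_forall {R : realType} {I : Type} (V : set I) n
    (P : 'I_n -> I -> R -> Prop) :
  (forall i, uniformly_near0 V (P i)) ->
  uniformly_near0 V (fun v t => forall i, P i v t).
Proof.
elim: n P => [|n IHn] P hP; first by exists 1 => // v t _ _ [].
have := uniformly_near0_and (hP ord0) (IHn _ (fun i => hP (lift ord0 i))).
apply: uniformly_near0_imply => v t _ _ [P0 PS] i.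
by case: (unliftP ord0 i) => [j|] ->.
Qed.

Lemma unifO_ge0 {R : realType} {I : Type} (V : set I) k (h : I -> R -> R) :
  unifO V k h ->
  exists2 B, 0 <= B & uniformly_near0 V (fun v t => `|h v t| <= B * t ^+ k).
Proof.
move=> [B hB]; exists `|B|; first exact: normr_ge0.
apply: uniformly_near0_imply hB => v t _ t_ge0 /le_trans; apply.
by rewrite ler_wpM2r ?exprn_ge0 ?ler_norm.
Qed.

Lemma unifO_dom {R : realType} {I : Type} (V : set I) k (f h : I -> R -> R) :
  unifO V k f ->
  uniformly_near0 V (fun v t => `|h v t| <= `|f v t|) -> unifO V k h.
Proof.
move=> [B hB] hfh; exists B.
apply: uniformly_near0_imply (uniformly_near0_and hB hfh) => v t _ _ [fB hf].
exact: le_trans hf fB.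
Qed.

Lemma unifO_eq {R : realType} {I : Type} (V : set I) k (f h : I -> R -> R) :
  unifO V k f -> uniformly_near0 V (fun v t => h v t = f v t) -> unifO V k h.
Proof.
move=> hf hfh; apply: unifO_dom hf _.
by apply: uniformly_near0_imply hfh => v t _ _ ->.
Qed.

Lemma unifO_ext {R : realType} {I : Type} (V : set I) k (f h : I -> R -> R) :
  unifO V k f -> (forall v t, V v -> h v t = f v t) -> unifO V k h.
Proof.
by move=> hf hfh; apply: unifO_eq hf _; exists 1 => // v t Vv _; exact: hfh.
Qed.

Lemma unifO_lower {R : realType} {I : Type} (V : set I) j k (h : I -> R -> R) :
  (j <= k)%N -> unifO V k h -> unifO V j h.
Proof.
move=> jk /unifO_ge0[B B_ge0 hB]; exists B.
apply: uniformly_near0_imply (uniformly_near0_and hB (uniformly_near0_le V ltr01)).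
move=> v t _ t_ge0 [hvt t_le1]; apply: le_trans hvt _.
by rewrite ler_wpM2l// ler_wiXn2l.
Qed.

Lemma unifOD {R : realType} {I : Type} (V : set I) k (f h : I -> R -> R) :
  unifO V k f -> unifO V k h -> unifO V k (fun v t => f v t + h v t).
Proof.
move=> [B hf] [C hh]; exists (B + C).
apply: uniformly_near0_imply (uniformly_near0_and hf hh) => v t _ _ [fB hC].
by rewrite (le_trans (ler_normD _ _))// mulrDl lerD.
Qed.

Lemma unifON {R : realType} {I : Type} (V : set I) k (f : I -> R -> R) :
  unifO V k f -> unifO V k (fun v t => - f v t).
Proof.
move=> hf; apply: unifO_dom hf _.
by exists 1 => // v t _ _; rewrite normrN.
Qed.

Lemma unifOB {R : realType} {I : Type} (V : set I) k (f h : I -> R -> R) :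
  unifO V k f -> unifO V k h -> unifO V k (fun v t => f v t - h v t).
Proof. by move=> hf hh; apply: unifOD => //; exact: unifON. Qed.

Lemma unifOM {R : realType} {I : Type} (V : set I) j k (f h : I -> R -> R) :
  unifO V j f -> unifO V k h -> unifO V (j + k) (fun v t => f v t * h v t).
Proof.
move=> [B hf] [C hh]; exists (B * C).
apply: uniformly_near0_imply (uniformly_near0_and hf hh) => v t _ _ [fB hC].
by rewrite normrM exprD mulrACA ler_pM.
Qed.

Lemma unifOMl {R : realType} {I : Type} (V : set I) k (f h : I -> R -> R) :
  unifO V 0 f -> unifO V k h -> unifO V k (fun v t => f v t * h v t).
Proof. exact: unifOM. Qed.

Lemma unifO_bounded {R : realType} {I : Type} (V : set I) (B : R)
    (h : I -> R -> R) :
  (forall v t, V v -> `|h v t| <= B) -> unifO V 0 h.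
Proof.
by move=> hB; exists B; exists 1 => // v t Vv _; rewrite expr0 mulr1 hB.
Qed.

Lemma unifO_cst {R : realType} {I : Type} (V : set I) (c : R) :
  unifO V 0 (fun _ _ => c).
Proof. exact: (@unifO_bounded _ _ _ `|c|). Qed.

Lemma unifO_X {R : realType} {I : Type} (V : set I) k :
  unifO V k (fun _ (t : R) => t ^+ k).
Proof.
by exists 1; exists 1 => // v t _ /andP[t_ge0 _]; rewrite mul1r ger0_norm ?exprn_ge0.
Qed.

Lemma unifO_sum {R : realType} {I : Type} (V : set I) k n
    (h : 'I_n -> I -> R -> R) :
  (forall i, unifO V k (h i)) -> unifO V k (fun v t => \sum_(i < n) h i v t).
Proof.
elim: n h => [|n IHn] h hO.
  exists 0; exists 1 => // v t _ _.
  by rewrite big_ord0 normr0 mul0r.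
apply: (@unifO_ext _ _ _ _
  (fun v t => (\sum_(i < n) h (widen_ord (leqnSn n) i) v t) + h ord_max v t)).
  by apply: unifOD => //; apply: IHn.
by move=> v t _; rewrite big_ord_recr.
Qed.

(** A family of order t is eventually below any threshold; this is how
   every smallness condition on the arc length is met uniformly. *)
Lemma unifO1_lt {R : realType} {I : Type} (V : set I) (h : I -> R -> R) e :
  0 < e -> unifO V 1 h -> uniformly_near0 V (fun v t => `|h v t| < e).
Proof.
move=> e_gt0 /unifO_ge0[B B_ge0 hB].
have B1_gt0 : 0 < B + 1 by rewrite ltr_wpDl.
have eB_gt0 : 0 < e / (B + 1) by rewrite divr_gt0.
apply: uniformly_near0_imply
  (uniformly_near0_and hB (uniformly_near0_le V eB_gt0)) => v t _ t_ge0 [ht te].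
apply: (le_lt_trans ht); rewrite expr1.
apply: (@le_lt_trans _ _ (B * (e / (B + 1)))); first by rewrite ler_wpM2l.
by rewrite mulrA ltr_pdivrMr// mulrC ltr_pM2l// ltrDl.
Qed.

Lemma unifO_comp {R : realType} {I : Type} (V : set I) k (phi : R -> R)
    (tau : I -> R -> R) :
  unifO [set: unit] k (fun _ => phi) -> unifO V 1 tau ->
  uniformly_near0 V (fun v t => 0 <= tau v t) ->
  unifO V k (fun v t => phi (tau v t)).
Proof.
move=> /unifO_ge0[B B_ge0 [e e_gt0 hB]] tau1 tau_ge0.
have [C hC] := tau1; exists (B * C ^+ k).
have := uniformly_near0_and hC (uniformly_near0_and tau_ge0 (unifO1_lt e_gt0 tau1)).
apply: uniformly_near0_imply => v t _ _ [tau_le [tau_nneg]].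
rewrite (ger0_norm tau_nneg) expr1 in tau_le * => /ltW tau_e.
apply: (le_trans (hB tt (tau v t) _ _)) => //; first by rewrite tau_nneg.
by rewrite -mulrA ler_wpM2l// -exprMn lerXn2r// nnegrE (le_trans _ tau_le).
Qed.

(** Integration gains one order, by the mean value theorem. Each Taylor
   expansion below is obtained by integrating the expansion of a derivative,
   so that no derivative of a geodesic beyond the second has to be bounded. *)
Lemma unifO_primitive {R : realType} {I : Type} (V : set I) k
    (h h' : I -> R -> R) :
  (forall v, V v -> h v 0 = 0) ->
  uniformly_near0 V (fun v t => is_derive t 1 (h v) (h' v t)) ->
  unifO V k h' -> unifO V k.+1 h.
Proof.
move=> h0 dh /unifO_ge0[B B_ge0 hB]; exists B.
move: (uniformly_near0_segment (uniformly_near0_and hB dh)).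
apply: uniformly_near0_imply => v t Vv t_ge0 ht.
have [||c] := @MVT_segment R (h v) (h' v) 0 t t_ge0.
- move=> u /[!in_itv]/= /andP[/ltW u_ge0 /ltW ut].
  by have [] := ht u; rewrite ?u_ge0.
- apply: derivable_within_continuous => u /[!in_itv]/= ut.
  by have [] := ht u.
rewrite in_itv/= h0// !subr0 => ct ->.
have [hc _] := ht c ct; have /andP[c_ge0 c_le] := ct.
rewrite normrM (ger0_norm t_ge0) exprSr mulrA ler_wpM2r//.
by apply: (le_trans hc); rewrite ler_wpM2l// lerXn2r.
Qed.

(** Families that are bounded and Lipschitz at t = 0, uniformly: a class
   closed under the field operations, in which the coefficients of the
   geodesic equation live. *)
Definition unif_lip0 {R : realType} {I : Type} (V : set I)
    (h : I -> R -> R) : Prop :=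
  unifO V 0 h /\ unifO V 1 (fun v t => h v t - h v 0).

Lemma unifO_at0 {R : realType} {I : Type} (V : set I) (h : I -> R -> R) :
  unifO V 0 h -> unifO V 0 (fun v _ => h v 0).
Proof.
move=> [B [s s_gt0 hB]]; exists B; exists s => // v t Vv _.
by rewrite expr0 -(expr0 0); apply: hB; rewrite ?lexx ?ltW.
Qed.

Lemma unif_lip0_of_diff {R : realType} {I : Type} (V : set I)
    (h : I -> R -> R) :
  unifO V 0 (fun v _ => h v 0) -> unifO V 1 (fun v t => h v t - h v 0) ->
  unif_lip0 V h.
Proof.
move=> h0 h1; split => //.
apply: (@unifO_ext _ _ _ _ (fun v t => h v 0 + (h v t - h v 0))).
  by apply: unifOD => //; exact: unifO_lower h1.
by move=> v t _; ring.
Qed.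

Lemma unif_lip0_eq {R : realType} {I : Type} (V : set I) (f h : I -> R -> R) :
  unif_lip0 V f -> uniformly_near0 V (fun v t => h v t = f v t) ->
  unif_lip0 V h.
Proof.
move=> [f0 f1] [s s_gt0 hf]; split; first by apply: unifO_eq f0 _; exists s.
apply: unifO_eq f1 _; exists s => // v t Vv ts.
by rewrite !hf// lexx ltW.
Qed.

Lemma unif_lip0M {R : realType} {I : Type} (V : set I) (f h : I -> R -> R) :
  unif_lip0 V f -> unif_lip0 V h -> unif_lip0 V (fun v t => f v t * h v t).
Proof.
move=> [f0 f1] [h0 h1]; split; first exact: unifOMl.
apply: (@unifO_ext _ _ _ _
  (fun v t => f v t * (h v t - h v 0) + h v 0 * (f v t - f v 0))).
  by apply: unifOD; apply: unifOMl => //; exact: unifO_at0.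
by move=> v t _; ring.
Qed.

Lemma unif_lip0N {R : realType} {I : Type} (V : set I) (f : I -> R -> R) :
  unif_lip0 V f -> unif_lip0 V (fun v t => - f v t).
Proof.
move=> [f0 f1]; split; first exact: unifON.
by apply: unifO_ext (unifON f1) _ => v t _; ring.
Qed.

Lemma unif_lip0_sum {R : realType} {I : Type} (V : set I) n
    (h : 'I_n -> I -> R -> R) :
  (forall i, unif_lip0 V (h i)) ->
  unif_lip0 V (fun v t => \sum_(i < n) h i v t).
Proof.
move=> hl; split; first by apply: unifO_sum => i; have [] := hl i.
apply: (@unifO_ext _ _ _ _ (fun v t => \sum_(i < n) (h i v t - h i v 0))).
  by apply: unifO_sum => i; have [] := hl i.
by move=> v t _; rewrite sumrB.
Qed.

(** 1/f - 1/f(0) = - (f - f(0)) / (f f(0)), and the lower bound m keeps the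
   denominator away from 0. *)
Lemma unif_lip0V {R : realType} {I : Type} (V : set I) (m : R)
    (f : I -> R -> R) :
  0 < m -> uniformly_near0 V (fun v t => m <= f v t) ->
  unif_lip0 V f -> unif_lip0 V (fun v t => (f v t)^-1).
Proof.
move=> m_gt0 [s s_gt0 mf] [f0 f1].
have invO : unifO V 0 (fun v t => (f v t)^-1).
  exists m^-1; exists s => // v t Vv ts; have f_ge := mf v t Vv ts.
  have f_gt0 := lt_le_trans m_gt0 f_ge.
  by rewrite expr0 mulr1 ger0_norm ?invr_ge0 ?(ltW f_gt0)// lef_pV2.
split => //.
apply: (@unifO_eq _ _ _ _
  (fun v t => - ((f v t)^-1 * (f v 0)^-1 * (f v t - f v 0)))).
  by apply: unifON; apply: unifOMl => //; apply: unifOMl => //; exact: unifO_at0 invO.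
exists s => // v t Vv ts.
have f_gt0 := lt_le_trans m_gt0 (mf v t Vv ts).
have f0_gt0 : 0 < f v 0 by apply: (lt_le_trans m_gt0); apply: mf => //; rewrite lexx ltW.
by field; rewrite !gt_eqF.
Qed.

(** * Inner product, curves and gradients *)

Lemma scalerRE {R : realType} (a b : R) : a *: b = a * b.
Proof. by []. Qed.

Lemma dotvC {R : realType} {n : nat} (u v : 'rV[R]_n) : dotv u v = dotv v u.
Proof. by apply: eq_bigr => i _; rewrite mulrC. Qed.

Lemma dotvDl {R : realType} {n : nat} (u v w : 'rV[R]_n) :
  dotv (u + v) w = dotv u w + dotv v w.
Proof. by rewrite -big_split; apply: eq_bigr => i _; rewrite !mxE mulrDl. Qed.

Lemma dotvZl {R : realType} {n : nat} a (u w : 'rV[R]_n) :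
  dotv (a *: u) w = a * dotv u w.
Proof. by rewrite mulr_sumr; apply: eq_bigr => i _; rewrite !mxE mulrA. Qed.

Lemma dotvNl {R : realType} {n : nat} (u w : 'rV[R]_n) :
  dotv (- u) w = - dotv u w.
Proof. by rewrite -scaleN1r dotvZl mulN1r. Qed.

Lemma dotvDr {R : realType} {n : nat} (w u v : 'rV[R]_n) :
  dotv w (u + v) = dotv w u + dotv w v.
Proof. by rewrite ![dotv w _]dotvC dotvDl. Qed.

Lemma dotvZr {R : realType} {n : nat} a (w u : 'rV[R]_n) :
  dotv w (a *: u) = a * dotv w u.
Proof. by rewrite ![dotv w _]dotvC dotvZl. Qed.

Lemma dotvNr {R : realType} {n : nat} (w u : 'rV[R]_n) :
  dotv w (- u) = - dotv w u.
Proof. by rewrite ![dotv w _]dotvC dotvNl. Qed.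

Definition dotvE := (@dotvDl, @dotvDr, @dotvNl, @dotvNr, @dotvZl, @dotvZr).

Lemma dotv_ge0 {R : realType} {n : nat} (u : 'rV[R]_n) : 0 <= dotv u u.
Proof. by apply: sumr_ge0 => i _; rewrite -expr2 sqr_ge0. Qed.

Lemma sqr_coord_le_dotv {R : realType} {n : nat} (u : 'rV[R]_n) i :
  u 0 i ^+ 2 <= dotv u u.
Proof.
rewrite /dotv (bigD1 i)//= -expr2 lerDl.
by apply: sumr_ge0 => j _; rewrite -expr2 sqr_ge0.
Qed.

Lemma dotv_eq0 {R : realType} {n : nat} (u : 'rV[R]_n) :
  (dotv u u == 0) = (u == 0).
Proof.
apply/eqP/eqP => [u0|->]; last by rewrite -(scale0r 0) dotvZl mul0r.
apply/rowP => i; rewrite mxE; apply/eqP.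
by rewrite -sqrf_eq0 eq_le sqr_ge0 andbT -u0 sqr_coord_le_dotv.
Qed.

Lemma enorm_sqr {R : realType} {n : nat} (u : 'rV[R]_n) :
  enorm u ^+ 2 = dotv u u.
Proof. by rewrite sqr_sqrtr// dotv_ge0. Qed.

(** The component w of a orthogonal to g satisfies dotv g w = 0, hence
   dotv a w = 0, and so dotv w w = 0. *)
Lemma collinear_of_orthogonal {R : realType} {n : nat} (g a : 'rV[R]_n) :
  g != 0 -> (forall w, dotv g w = 0 -> dotv a w = 0) ->
  a = (dotv g a / dotv g g) *: g.
Proof.
move=> g_neq0 ha; have gg_neq0 : dotv g g != 0 by rewrite dotv_eq0.
pose w := a - (dotv g a / dotv g g) *: g.
have gw : dotv g w = 0 by rewrite /w !dotvE divfK// subrr.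
apply/eqP; rewrite -subr_eq0 -dotv_eq0 -/w {1}/w dotvDl dotvNl dotvZl.
by rewrite ha// gw mulr0 subrr.
Qed.

Lemma is_derive_coord {R : realType} {n : nat} (g : R -> 'rV[R]_n.+1) t i :
  derivable g t 1 ->
  is_derive t 1 (fun u => g u 0 i) (derive1 g t 0 i).
Proof.
move=> dg; apply: DeriveDef; first by move/derivable_mxP : dg; apply.
by rewrite derive1E derive_mx// mxE.
Qed.

Lemma is_derive_dotv {R : realType} {n : nat} (g h : R -> 'rV[R]_n.+1) t :
  derivable g t 1 -> derivable h t 1 ->
  is_derive t 1 (fun u => dotv (g u) (h u))
    (dotv (derive1 g t) (h t) + dotv (g t) (derive1 h t)).
Proof.
move=> dg dh.
have -> : (fun u => dotv (g u) (h u)) =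
    \sum_(i < n.+1) ((fun u => g u 0 i) * (fun u => h u 0 i)).
  by apply/funext => u; rewrite fct_sumE.
rewrite -big_split; apply: is_derive_sum => i /=.
have dgi := is_derive_coord i dg; have dhi := is_derive_coord i dh.
by apply: is_derive_eq; rewrite addrC [h t 0 i *: _]mulrC.
Qed.

Lemma is_derive_comp_curve {R : realType} {n : nat} (f : 'rV[R]_n.+1 -> R)
    (g : R -> 'rV[R]_n.+1) t :
  differentiable f (g t) -> derivable g t 1 ->
  is_derive t 1 (fun u => f (g u)) ('d f (g t) (derive1 g t)).
Proof.
move=> df /derivable1_diffP dg; have dfg := differentiable_comp dg df.
apply: DeriveDef; first exact: diff_derivable.
by rewrite deriveE// diff_comp//= derive1E'.
Qed.

Lemma is_derive_curve_subr {R : realType} {n : nat} (g : R -> 'rV[R]_n.+1) x t :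
  derivable g t 1 -> is_derive t 1 (fun u => g u - x) (derive1 g t).
Proof.
move=> dg; rewrite derive1E -[X in is_derive _ _ _ X]subr0.
exact: is_deriveB (derivableP dg) (is_derive_cst x t 1).
Qed.

Definition gradient {R : realType} {n : nat} (f : 'rV[R]_n.+1 -> R)
    (z : 'rV[R]_n.+1) : 'rV[R]_n.+1 :=
  \row_i 'd f z (delta_mx 0 i).

Lemma diff_gradient {R : realType} {n : nat} (f : 'rV[R]_n.+1 -> R) z w :
  'd f z w = dotv (gradient f z) w.
Proof.
rewrite [in LHS](row_sum_delta w) linear_sum; apply: eq_bigr => i _.
by rewrite linearZ mxE mulrC.
Qed.

(** * The geodesic equation *)

Lemma smooth_on_differentiable {R : realType} {n : nat} (U : set 'rV[R]_n.+1) f :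
  smooth_on U f -> forall z, U z -> differentiable f z.
Proof. by move=> /(_ 1%N)[]. Qed.

Lemma curve_near_open {R : realType} {n : nat} (U : set 'rV[R]_n.+1)
    (g : R -> 'rV[R]_n.+1) t :
  open U -> U (g t) -> derivable g t 1 -> \forall u \near t, U (g u).
Proof.
move=> oU Ugt /derivable1_diffP/differentiable_continuous gc.
by apply: gc; exact: open_nbhs_nbhs.
Qed.

Lemma defining_function_velocity {R : realType} {d : nat}
    (M U : set 'rV[R]_d.+1) (f : 'rV[R]_d.+1 -> R) (g : R -> 'rV[R]_d.+1) t :
  local_defining_function M U f -> smooth_curve g -> (forall u, M (g u)) ->
  U (g t) -> 'd f (g t) (derive1 g t) = 0.
Proof.
move=> [oU sf _ MU] sg gM Ugt.
have dfg := is_derive_comp_curve (smooth_on_differentiable sf Ugt) (sg 0 t).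
have d0 : is_derive t 1 (fun u => f (g u)) (0 : R).
  apply: near_eq_is_derive (is_derive_cst 0 t 1).
  apply: filterS (curve_near_open oU Ugt (sg 0 t)) => u Ugu.
  have : (M `&` U) (g u) by split.
  by rewrite MU => -[_ ->].
by rewrite -(@derive_val _ _ _ _ _ _ _ dfg) derive_val.
Qed.

Lemma velocity_tangent {R : realType} {d : nat} (M : set 'rV[R]_d.+1)
    (g : R -> 'rV[R]_d.+1) t :
  smooth_hypersurface M -> smooth_curve g -> (forall u, M (g u)) ->
  tangent_space M (g t) (derive1 g t).
Proof.
move=> hM sg gM; have [U [f [Ugt hf]]] := hM _ (gM t).
by exists U, f; split=> //; exact: defining_function_velocity hf _ _ _.
Qed.

(** The derivative of |g'|^2 is 2 g'' . g', and g'' is normal while g' is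
   tangent. *)
Lemma geodesic_speed {R : realType} {d : nat} (M : set 'rV[R]_d.+1)
    (g : R -> 'rV[R]_d.+1) t :
  smooth_hypersurface M -> geodesic M g ->
  dotv (derive1 g t) (derive1 g t) = dotv (derive1 g 0) (derive1 g 0).
Proof.
move=> hM [sg gM gN].
apply: (is_derive_0_is_cst (f := fun u => dotv (derive1 g u) (derive1 g u))) => u.
have tan_u := gN _ _ (velocity_tangent u hM sg gM).
apply: (is_derive_eq (is_derive_dotv (sg 1%N u) (sg 1%N u))).
by rewrite [X in _ + X]dotvC -[X in dotv X _]/(derive1n 2 g u) tan_u addr0.
Qed.

(** The acceleration of a geodesic is normal to ker df, hence is a multiple of
   the gradient G of f; differentiating df(g') = 0 along g finds the multiple.
   This expresses g'' through f and g' alone, which is where the regularity of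
   the acceleration, uniform over all geodesics from a point, comes from. *)
Lemma geodesic_equation {R : realType} {d : nat}
    (M U : set 'rV[R]_d.+1) (f : 'rV[R]_d.+1 -> R) (g : R -> 'rV[R]_d.+1) t :
  local_defining_function M U f -> geodesic M g -> U (g t) ->
  derive1n 2 g t =
    (- (\sum_(i < d.+1) 'd (fun z => 'd f z (delta_mx 0 i)) (g t) (derive1 g t)
         * derive1 g t 0 i)
      / dotv (gradient f (g t)) (gradient f (g t))) *: gradient f (g t).
Proof.
move=> hf [sg gM gN] Ugt; have [oU sf df_neq0 _] := hf.
set G := gradient f (g t); set a := derive1n 2 g t.
have G_neq0 : G != 0.
  have [v] := df_neq0 _ Ugt; rewrite diff_gradient -/G.
  by apply: contraNneq => ->; rewrite -(scale0r 0) dotvZl mul0r.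
have a_perp w : dotv G w = 0 -> dotv a w = 0.
  by move=> Gw; apply: gN; exists U, f; split; rewrite ?diff_gradient.
rewrite {1}(collinear_of_orthogonal G_neq0 a_perp); congr (_ / _ *: _).
have ddf i := (sf 2%N).2 (delta_mx 0 i).
pose F i (u : R) := 'd f (g u) (delta_mx 0 i).
have dF i : is_derive t 1 (F i)
    ('d (fun z => 'd f z (delta_mx 0 i)) (g t) (derive1 g t)).
  by apply: is_derive_comp_curve (sg 0 t); apply: (ddf i).1.
have dg i : is_derive t 1 (fun u => derive1 g u 0 i) (a 0 i).
  exact: is_derive_coord (sg 1%N t).
have dsum := is_derive_sum (fun i => is_deriveM (dF i) (dg i)).
have d0 : is_derive t 1 (\sum_(i < d.+1) F i * (fun u => derive1 g u 0 i)) (0 : R).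
  apply: near_eq_is_derive (is_derive_cst 0 t 1).
  apply: filterS (curve_near_open oU Ugt (sg 0 t)) => u Ugu.
  rewrite /cst -(defining_function_velocity hf sg gM Ugu) diff_gradient fct_sumE.
  by apply: eq_bigr => i _; rewrite mxE.
have -> : dotv G a = \sum_(i < d.+1) F i t * a 0 i.
  by apply: eq_bigr => i _; rewrite mxE.
have := @derive_val _ _ _ _ _ _ _ dsum; rewrite derive_val big_split/= => /esym/eqP.
rewrite addr_eq0 => /eqP ->; congr (- _); apply: eq_bigr => i _.
exact: mulrC.
Qed.

(** * Unit-speed geodesics from a point *)

Definition unit_geodesics {R : realType} {d : nat} (M : set 'rV[R]_d.+1)
    (x : 'rV[R]_d.+1) : set (R -> 'rV[R]_d.+1) :=
  [set g | [/\ geodesic M g, g 0 = x & enorm (derive1 g 0) = 1]].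

Section UnitGeodesics.
Context {R : realType} {d : nat} (M : set 'rV[R]_d.+1) (x : 'rV[R]_d.+1).
Context (hM : smooth_hypersurface M).
Let V := unit_geodesics M x.

Lemma unit_geodesic_speed g t : V g -> dotv (derive1 g t) (derive1 g t) = 1.
Proof.
by move=> [hg _ g1]; rewrite (geodesic_speed t hM hg) -enorm_sqr g1 expr1n.
Qed.

Lemma unit_geodesic_acc_orthogonal g t :
  V g -> dotv (derive1n 2 g t) (derive1 g t) = 0.
Proof. by move=> [[sg gM gN] _ _]; apply/gN/velocity_tangent. Qed.

(** Unit speed bounds every coordinate of the velocity by 1. *)
Lemma unifO_velocity i : unifO V 0 (fun g t => derive1 g t 0 i).
Proof.
apply: (@unifO_bounded _ _ _ 1) => g t Vg.
rewrite -(@ler_pXn2r _ 2)// ?nnegrE ?ler01// expr1n real_normK ?num_real//.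
by rewrite -(unit_geodesic_speed t Vg) sqr_coord_le_dotv.
Qed.

Lemma unifO_position i : unifO V 1 (fun g t => g t 0 i - x 0 i).
Proof.
apply: unifO_primitive (unifO_velocity i).
  by move=> g [_ -> _]; rewrite subrr.
exists 1 => // g t [[sg _ _] _ _] _.
have dgi := is_derive_coord i (sg 0 t).
have -> : (fun u => g u 0 i - x 0 i) = (fun u => g u 0 i) - cst (x 0 i).
  by apply/funext.
by apply: is_derive_eq; rewrite subr0.
Qed.

(** All unit-speed geodesics from x stay in a given neighbourhood of x during
   a common time, since they move at most t in time t. *)
Lemma uniformly_near0_geodesic (P : set 'rV[R]_d.+1) :
  nbhs x P -> uniformly_near0 V (fun g t => P (g t)).
Proof.
move=> /nbhs_ballP[e /= e_gt0 eP].
have := uniformly_near0_forall (fun i => unifO1_lt e_gt0 (unifO_position i)).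
apply: uniformly_near0_imply => g t _ _ ge; apply: eP; split => // i j.
by rewrite ord1 /ball/= distrC.
Qed.

Lemma unifO_continuous (phi : 'rV[R]_d.+1 -> R) :
  {for x, continuous phi} -> unifO V 0 (fun g t => phi (g t)).
Proof.
move=> phic; exists (`|phi x| + 1).
suff /uniformly_near0_geodesic : \forall z \near x, `|phi z| <= `|phi x| + 1.
  by apply: uniformly_near0_imply => g t _ _ /=; rewrite expr0 mulr1.
have /cvgrPdist_le/(_ 1 ltr01) := phic; apply: filterS => z /= hz.
rewrite -lerBlDl; apply: le_trans hz.
by rewrite distrC lerB_dist.
Qed.

Lemma unif_lip0_C1 (U : set 'rV[R]_d.+1) (phi : 'rV[R]_d.+1 -> R) :
  open U -> U x -> Ck_on 1 U phi -> unif_lip0 V (fun g t => phi (g t)).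
Proof.
move=> oU Ux [dphi cphi].
apply: unif_lip0_of_diff.
  by apply: (@unifO_bounded _ _ _ `|phi x|) => g t [_ -> _].
pose phi' (g : R -> 'rV[R]_d.+1) t := 'd phi (g t) (derive1 g t).
apply: (@unifO_primitive _ _ _ _ _ phi').
- by move=> g _; rewrite subrr.
- apply: uniformly_near0_imply (uniformly_near0_geodesic (open_nbhs_nbhs (conj oU Ux))).
  move=> g t [[sg _ _] _ _] _ Ugt.
  have dgphi := is_derive_comp_curve (dphi _ Ugt) (sg 0 t).
  have -> : (fun u => phi (g u) - phi (g 0)) = (fun u => phi (g u)) - cst (phi (g 0)).
    by apply/funext.
  by apply: is_derive_eq; rewrite subr0.
- apply: (@unifO_ext _ _ _ _ (fun g t =>
    \sum_(i < d.+1) 'd phi (g t) (delta_mx 0 i) * derive1 g t 0 i)).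
    apply: unifO_sum => i; apply: unifOMl; last exact: unifO_velocity.
    exact: unifO_continuous (cphi (delta_mx 0 i) _ Ux).
  by move=> g t _; rewrite /phi' diff_gradient; apply: eq_bigr => i _; rewrite mxE.
Qed.

(** Every coefficient of the geodesic equation is a partial derivative of f
   along g, of order one or two, or a coordinate of g'; the former are
   Lipschitz because f is C^3 and g has unit speed, the latter because g'' is
   then bounded. The algebra of uniformly Lipschitz families does the rest. *)
Lemma unif_lip0_acceleration i :
  M x -> unif_lip0 V (fun g t => derive1n 2 g t 0 i).
Proof.
move=> /hM[U [f [Ux hf]]]; have [oU sf df_neq0 _] := hf.
have Ck_grad k j : Ck_on k U (fun z => 'd f z (delta_mx 0 j)).
  exact: (sf k.+1).2.
pose N (g : R -> 'rV[R]_d.+1) t := dotv (gradient f (g t)) (gradient f (g t)) : R.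
pose dd j k z := 'd (fun z => 'd f z (delta_mx 0 j)) z (delta_mx 0 k) : R.
have accE j : uniformly_near0 V (fun g t => derive1n 2 g t 0 j =
   - (\sum_(j < d.+1) (\sum_(k < d.+1)
     dd j k (g t) * derive1 g t 0 k) * derive1 g t 0 j) * (N g t)^-1
   * 'd f (g t) (delta_mx 0 j)).
  apply: uniformly_near0_imply
    (uniformly_near0_geodesic (open_nbhs_nbhs (conj oU Ux))).
  move=> g t [hg _ _] _ Ugt; rewrite (geodesic_equation hf hg Ugt) !mxE.
  congr (- _ / _ * _); apply: eq_bigr => j' _; congr (_ * _).
  by rewrite diff_gradient; apply: eq_bigr => k _; rewrite mxE.
have lip_grad j : unif_lip0 V (fun g t => 'd f (g t) (delta_mx 0 j)).
  exact: unif_lip0_C1 oU Ux (Ck_grad 1%N j).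
have lip_dd j k : unif_lip0 V (fun g t => dd j k (g t)).
  exact: unif_lip0_C1 oU Ux ((Ck_grad 2%N j).2 _).
have lip_N : unif_lip0 V N.
  apply: (@unif_lip0_eq _ _ _ (fun g t => \sum_(j < d.+1)
      'd f (g t) (delta_mx 0 j) * 'd f (g t) (delta_mx 0 j))).
    by apply: unif_lip0_sum => j; exact: unif_lip0M.
  by exists 1 => // g t _ _; apply: eq_bigr => j _; rewrite mxE.
pose m := dotv (gradient f x) (gradient f x).
have m_gt0 : 0 < m.
  rewrite lt_def dotv_ge0 andbT dotv_eq0.
  have [v] := df_neq0 _ Ux; rewrite diff_gradient.
  by apply: contraNneq => ->; rewrite -(scale0r 0) dotvZl mul0r.
(* N does not vanish at x, so it stays above N(x) / 2 for a common time. *)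
have lip_invN : unif_lip0 V (fun g t => (N g t)^-1).
  apply: (@unif_lip0V _ _ _ (m / 2)) => //; first by rewrite divr_gt0.
  have /unifO1_lt : unifO V 1 (fun g t => N g t - N g 0) by case: lip_N.
  move=> /(_ (m / 2)); rewrite divr_gt0// => /(_ isT).
  apply: uniformly_near0_imply => g t [_ g0 _] _.
  by rewrite {2}/N g0 -/m ltr_norml => /andP[+ _]; lra.
have O_acc j : unifO V 0 (fun g t => derive1n 2 g t 0 j).
  apply: unifO_eq (accE j).
  apply: unifOMl; last by case: (lip_grad j).
  apply: unifOMl; last by case: lip_invN.
  apply: unifON; apply: unifO_sum => j'; apply: unifOMl.
    apply: unifO_sum => k; apply: unifOMl; last exact: unifO_velocity.
    by case: (lip_dd j' k).
  exact: unifO_velocity.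
have lip_vel j : unif_lip0 V (fun g t => derive1 g t 0 j).
  apply: unif_lip0_of_diff.
    exact: unifO_at0 (unifO_velocity j).
  apply: unifO_primitive (O_acc j); first by move=> g _; rewrite subrr.
  exists 1 => // g t [[sg _ _] _ _] _.
  have dgi := is_derive_coord j (sg 1%N t).
  have -> : (fun u => derive1 g u 0 j - derive1 g 0 0 j) =
      (fun u => derive1 g u 0 j) - cst (derive1 g 0 0 j) by apply/funext.
  by apply: is_derive_eq; rewrite subr0.
apply: unif_lip0_eq (accE i).
apply: unif_lip0M => //; apply: unif_lip0M => //; apply: unif_lip0N.
apply: unif_lip0_sum => j; apply: unif_lip0M => //.
by apply: unif_lip0_sum => k; exact: unif_lip0M.
Qed.

End UnitGeodesics.

(** * Expansion of a geodesic to third order *)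

(** T_xM is a hyperplane, so its orthogonal complement is spanned by the unit
   vector n. *)
Lemma normal_collinear {R : realType} {d : nat} (M : set 'rV[R]_d.+1)
    (x n a : 'rV[R]_d.+1) :
  smooth_hypersurface M -> M x -> unit_normal M x n ->
  (forall w, tangent_space M x w -> dotv a w = 0) -> a = dotv n a *: n.
Proof.
move=> hM /hM[U [f [Ux hf]]] [n1 n_perp] a_perp.
have [_ _ df_neq0 _] := hf.
have G_neq0 : gradient f x != 0.
  have [v] := df_neq0 _ Ux; rewrite diff_gradient.
  by apply: contraNneq => ->; rewrite -(scale0r 0) dotvZl mul0r.
have ker_tan w : dotv (gradient f x) w = 0 -> tangent_space M x w.
  by move=> Gw; exists U, f; split; rewrite ?diff_gradient.
have nn : dotv n n = 1 by rewrite -enorm_sqr n1 expr1n.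
have n_neq0 : n != 0 by rewrite -dotv_eq0 nn oner_eq0.
rewrite {1}(@collinear_of_orthogonal _ _ n a n_neq0) ?nn ?divr1// => w nw.
apply/a_perp/ker_tan; move: nw.
rewrite (collinear_of_orthogonal G_neq0 (fun w Gw => n_perp w (ker_tan w Gw))).
rewrite dotvZl => /eqP; rewrite mulf_eq0 => /orP[/eqP c0|/eqP//].
move: n_neq0; rewrite (collinear_of_orthogonal G_neq0
  (fun w Gw => n_perp w (ker_tan w Gw))) c0 scale0r.
by rewrite eqxx.
Qed.

Lemma unifO_dotv {R : realType} {I : Type} {m : nat} (V : set I) j k
    (f h : I -> R -> 'rV[R]_m) :
  (forall i, unifO V j (fun v t => f v t 0 i)) ->
  (forall i, unifO V k (fun v t => h v t 0 i)) ->
  unifO V (j + k) (fun v t => dotv (f v t) (h v t)).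
Proof. by move=> fO hO; apply: unifO_sum => i; exact: unifOM. Qed.

Section Expansions.
Context {R : realType} {d : nat} (M : set 'rV[R]_d.+1) (x n : 'rV[R]_d.+1).
Context (hM : smooth_hypersurface M) (hx : M x) (hn : unit_normal M x n).
Let V := unit_geodesics M x.

(** The normal curvature of M in the direction of g, as a coordinate of g''(0)
   along n. *)
Definition curvature_at0 (g : R -> 'rV[R]_d.+1) : R := dotv n (derive1n 2 g 0).
Local Notation kappa := curvature_at0.

Lemma acceleration_at0 g : V g -> derive1n 2 g 0 = kappa g *: n.
Proof.
move=> [[_ _ gN] g0 _]; rewrite /curvature_at0.
apply: (normal_collinear hM hx hn) => w; rewrite -{1}g0; exact: gN.
Qed.

Lemma dotv_normal_self : dotv n n = 1.
Proof. by have [n1 _] := hn; rewrite -enorm_sqr n1 expr1n. Qed.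

Lemma dotv_normal_velocity g : V g -> dotv n (derive1 g 0) = 0.
Proof.
move=> [[sg gM _] g0 _]; apply: hn.2; rewrite -g0.
exact: velocity_tangent.
Qed.

Lemma unifO_acceleration i : unifO V 0 (fun g t => derive1n 2 g t 0 i).
Proof. by case: (unif_lip0_acceleration hM i hx). Qed.

Lemma unifO_curvature : unifO V 0 (fun g _ => kappa g).
Proof.
apply: (unifO_at0 (h := fun g t => dotv n (derive1n 2 g t))).
apply: (@unifO_dotv _ _ _ _ 0 0) => i; last exact: unifO_acceleration.
exact: unifO_cst.
Qed.

Lemma acceleration_expansion i :
  unifO V 1 (fun g t => (derive1n 2 g t - kappa g *: n) 0 i).
Proof.
have [_] := unif_lip0_acceleration hM i hx; move/unifO_ext; apply => g t Vg.
by rewrite -acceleration_at0// !mxE.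
Qed.

Lemma velocity_expansion i : unifO V 2
  (fun g t => (derive1 g t - derive1 g 0 - (t * kappa g) *: n) 0 i).
Proof.
apply: unifO_primitive (acceleration_expansion i).
  by move=> g _; rewrite subrr mul0r scale0r subrr mxE.
exists 1 => // g t [[sg _ _] _ _] _.
have dgi := is_derive_coord i (sg 1%N t).
have -> : (fun u => (derive1 g u - derive1 g 0 - (u * kappa g) *: n) 0 i) =
    (fun u => derive1 g u 0 i) - cst (derive1 g 0 0 i) - kappa g * n 0 i \*: id.
  by apply/funext => u; rewrite !mxE !fctE/= !scalerRE; ring.
apply: is_derive_eq.
by rewrite subr0 !mxE !scalerRE mulr1.
Qed.

Lemma position_expansion i : unifO V 3
  (fun g t => (g t - x - t *: derive1 g 0 - (t ^+ 2 / 2 * kappa g) *: n) 0 i).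
Proof.
apply: unifO_primitive (velocity_expansion i).
  move=> g [_ -> _].
  by rewrite subrr expr0n/= !mul0r !scale0r !subr0 mxE.
exists 1 => // g t [[sg _ _] _ _] _.
have dgi := is_derive_coord i (sg 0 t).
have -> : (fun u => (g u - x - u *: derive1 g 0 - (u ^+ 2 / 2 * kappa g) *: n) 0 i) =
    (fun u => g u 0 i) - cst (x 0 i) - derive1 g 0 0 i \*: id
    - (kappa g * n 0 i / 2) \*: (id ^+ 2).
  by apply/funext => u; rewrite !mxE !fctE/= !scalerRE; ring.
apply: is_derive_eq.
by rewrite subr0 !mxE !scalerRE !mulr1 expr1; field.
Qed.

Lemma normal_expansion :
  unifO V 3 (fun g t => dotv n (g t - x) - kappa g / 2 * t ^+ 2).
Proof.
apply: (@unifO_ext _ _ _ _ (fun g t =>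
    dotv n (g t - x - t *: derive1 g 0 - (t ^+ 2 / 2 * kappa g) *: n))).
  apply: (@unifO_dotv _ _ _ _ 0 3) => i; first exact: unifO_cst.
  exact: position_expansion.
move=> g t Vg; rewrite !dotvE dotv_normal_self dotv_normal_velocity//.
by field.
Qed.

(** With g - x = t v + (t^2/2) kappa n + e0 and g' = v + t kappa n + e1, one gets
     g - x = t g' - t e1 - (t^2/2) kappa n + e0,
   and the leading term disappears against g'' because g'' . g' = 0. The error
   is thus O(t^3) although g'' is only known up to O(t). *)
Lemma position_acceleration_expansion : unifO V 3
  (fun g t => dotv (g t - x) (derive1n 2 g t) + kappa g ^+ 2 / 2 * t ^+ 2).
Proof.
pose e2 g t := derive1n 2 g t - kappa g *: n.
pose e1 g t := derive1 g t - derive1 g 0 - (t * kappa g) *: n.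
pose e0 g t := g t - x - t *: derive1 g 0 - (t ^+ 2 / 2 * kappa g) *: n.
apply: (@unifO_ext _ _ _ _ (fun g t =>
    kappa g * (- 2^-1 * (t ^+ 2 * dotv n (e2 g t)))
    - t ^+ 1 * dotv (e1 g t) (derive1n 2 g t)
    + dotv (e0 g t) (derive1n 2 g t))).
  apply: unifOD; last first.
    apply: (@unifO_dotv _ _ _ _ 3 0) => i; last exact: unifO_acceleration.
    exact: position_expansion.
  apply: unifOB.
    apply: unifOMl; first exact: unifO_curvature.
    apply: unifOMl; first exact: unifO_cst.
    apply: (@unifOM _ _ _ 2 1); first exact: unifO_X.
    apply: (@unifO_dotv _ _ _ _ 0 1) => i; first exact: unifO_cst.
    exact: acceleration_expansion.
  apply: (@unifOM _ _ _ 1 2); first exact: unifO_X.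
  apply: (@unifO_dotv _ _ _ _ 2 0) => i; last exact: unifO_acceleration.
  exact: velocity_expansion.
move=> g t Vg; rewrite /e0 /e1 /e2.
have gg : dotv (derive1 g t) (derive1n 2 g t) = 0.
  by rewrite dotvC (unit_geodesic_acc_orthogonal hM t Vg).
by rewrite !dotvE gg dotv_normal_self; field.
Qed.

Lemma position_velocity_expansion : unifO V 4
  (fun g t => dotv (g t - x) (derive1 g t) - t + kappa g ^+ 2 / 6 * t ^+ 3).
Proof.
apply: unifO_primitive position_acceleration_expansion.
  move=> g [_ -> _]; rewrite !dotvE expr0n/=; ring.
exists 1 => // g t Vg _; have [[sg _ _] _ _] := Vg.
have [dgx dgxE] := is_derive_curve_subr x (sg 0%N t).
have dot_gg := is_derive_dotv dgx (sg 1%N t).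
have -> : (fun u => dotv (g u - x) (derive1 g u) - u + kappa g ^+ 2 / 6 * u ^+ 3) =
    (fun u => dotv (g u - x) (derive1 g u)) - id + (kappa g ^+ 2 / 6) \*: (id ^+ 3).
  by apply/funext.
apply: is_derive_eq.
by rewrite derive1E dgxE (unit_geodesic_speed hM t Vg) !scalerRE; field.
Qed.

(** The squared chord is integrated twice from (g - x) . g''; its O(t^5) error
   is one order better than the expansion of g itself would give. *)
Lemma chord_expansion : unifO V 5
  (fun g t => dotv (g t - x) (g t - x) - t ^+ 2 + kappa g ^+ 2 / 12 * t ^+ 4).
Proof.
apply: unifO_primitive (unifOMl (unifO_cst V 2) position_velocity_expansion).
  move=> g [_ -> _]; rewrite !dotvE !expr0n/=; ring.
exists 1 => // g t Vg _; have [[sg _ _] _ _] := Vg.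
have [dgx dgxE] := is_derive_curve_subr x (sg 0%N t).
have dot_gg := is_derive_dotv dgx dgx.
have -> : (fun u => dotv (g u - x) (g u - x) - u ^+ 2 + kappa g ^+ 2 / 12 * u ^+ 4) =
    (fun u => dotv (g u - x) (g u - x)) - id ^+ 2 + (kappa g ^+ 2 / 12) \*: (id ^+ 4).
  by apply/funext.
apply: is_derive_eq.
by rewrite derive1E dgxE [dotv (derive1 g t) _]dotvC !scalerRE; field.
Qed.

End Expansions.

(** * Spherical distance and angles *)

(** sin x = 2 sin (x/2) cos (x/2), where sin (x/2) >= (x/2) cos (pi/3) by the mean
   value theorem. The range 2 pi / 3 leaves room above pi / 2 for the sum of an
   acute angle and a small one. *)
Lemma sin_lower_bound {R : realType} (x : R) :
  0 <= x <= 2 * (pi / 3) -> cos (pi / 3) ^+ 2 * x <= sin x.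
Proof.
move=> /andP[x_ge0 x_le]; have pi_gt0 := pi_gt0 R.
pose y := x / 2; have xE : x = y *+ 2 by rewrite -mulr_natr divfK.
have y_ge0 : 0 <= y by rewrite divr_ge0.
have y_le : y <= pi / 3 by rewrite ler_pdivrMr// mulrC.
have a_ge0 : 0 <= cos (pi / 3 : R) by apply: cos_ge0_pihalf; lra.
have cos_ge z : 0 <= z <= y -> cos (pi / 3) <= cos z.
  move=> /andP[z_ge0 zy]; rewrite leNgt ltr_cos ?in_itv/=; first lra.
    by apply/andP; split; lra.
  by apply/andP; split; lra.
have [c cy sinyE] := @MVT_segment R sin cos 0 y y_ge0 (fun z _ => is_derive_sin z)
  (continuous_subspaceT (@continuous_sin R)).
move: sinyE; rewrite sin0 !subr0 => sinyE.
have siny_ge : cos (pi / 3) * y <= sin y.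
  by rewrite sinyE ler_wpM2r// cos_ge// -in_itv.
rewrite xE sin_mulr2n mulrnAr lerMn2r/= expr2 -mulrA.
by apply: ler_pM => //; [rewrite mulr_ge0 | rewrite cos_ge ?y_ge0 ?lexx].
Qed.

(** sin^2 a - sin^2 b = sin (a + b) sin (a - b), and both factors are bounded
   below by multiples of their arguments. *)
Lemma angle_diff_le_sin_sqr {R : realType} (a b : R) :
  0 <= a <= pi / 2 -> 0 <= b <= pi / 6 ->
  cos (pi / 3) ^+ 4 * ((a + b) * `|a - b|) <= `|sin a ^+ 2 - sin b ^+ 2|.
Proof.
move=> /andP[a_ge0 a_le] /andP[b_ge0 b_le]; have pi_gt0 := pi_gt0 R.
have -> : sin a ^+ 2 - sin b ^+ 2 = sin (a + b) * sin (a - b).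
  rewrite sinD sinB.
  by have := cos2sin2 a; have := cos2sin2 b; nra.
have sinN_norm (z : R) : `|sin `|z| | = `|sin z|.
  by case: (lerP 0 z) => [/ger0_norm->//|/ltr0_norm->]; rewrite sinN normrN.
rewrite normrM -(sinN_norm (a - b)) (exprD _ 2 2) mulrACA.
have c2_ge0 : 0 <= cos (pi / 3 : R) ^+ 2 := sqr_ge0 _.
apply: ler_pM; rewrite ?(mulr_ge0 c2_ge0) ?addr_ge0//.
- apply: (le_trans _ (ler_norm _)); apply: sin_lower_bound; apply/andP; split; lra.
- apply: (le_trans _ (ler_norm _)); apply: sin_lower_bound; rewrite normr_ge0/=.
  by rewrite ler_norml; apply/andP; split; lra.
Qed.

(** theta is the angle at the centre c = x + n/k between x and y, with
     cos theta = (1 - k b) / sqrt Q,  b = n . (y - x),  Q = k^2 |y - c|^2.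
   The last formula gives its squared sine with cleared denominator, so that it
   holds at y = c too: there both sides vanish. *)
Lemma sphere_dist_angle {R : realType} {d : nat} (x n y : 'rV[R]_d.+1) (k : R) :
  dotv n n = 1 -> k != 0 ->
  exists theta, [/\ sphere_dist (x + k^-1 *: n) `|k|^-1 x y = `|k|^-1 * theta,
    0 <= theta <= pi,
    (k * dotv n (y - x) <= 1 -> theta <= pi / 2) &
    (1 - 2 * (k * dotv n (y - x)) + k ^+ 2 * dotv (y - x) (y - x))
      * sin theta ^+ 2 = k ^+ 2 * (dotv (y - x) (y - x) - dotv n (y - x) ^+ 2)].
Proof.
move=> nn k_neq0.
have nk_neq0 : `|k| != 0 by rewrite normr_eq0.
have k2 : `|k| ^+ 2 = k ^+ 2 by rewrite real_normK ?num_real.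
have [w wE] : exists w, y - x = w by exists (y - x).
rewrite wE; set b := dotv n w; set ww := dotv w w.
pose Q := 1 - 2 * (k * b) + k ^+ 2 * ww.
have pE : y - (x + k^-1 *: n) = w - k^-1 *: n by rewrite opprD addrA wE.
have [p pE'] : exists p, w - k^-1 *: n = p by exists (w - k^-1 *: n).
have pp : dotv p p = Q / k ^+ 2.
  by rewrite -pE' !dotvE nn [dotv w n]dotvC -/b -/ww /Q; field.
have b2_le : b ^+ 2 <= ww.
  have := dotv_ge0 (w - b *: n).
  by rewrite !dotvE nn [dotv w n]dotvC -/b -/ww; lra.
have Q_ge0 : 0 <= Q.
  by rewrite -[Q](divfK (expf_neq0 2 k_neq0)) -pp mulr_ge0 ?dotv_ge0 ?sqr_ge0.
have xc : x - (x + k^-1 *: n) = - k^-1 *: n by rewrite opprD addrA subrr add0r scaleNr.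
have enx : enorm (x - (x + k^-1 *: n)) = `|k|^-1.
  by rewrite xc /enorm !dotvE nn mulr1 -normfV -sqrtr_sqr expr2 mulrNN.
pose X := (1 - k * b) / Num.sqrt Q.
have enp : enorm p = Num.sqrt Q / `|k|.
  rewrite /enorm pp sqrtrM// sqrtrV ?sqr_ge0// sqrtr_sqr.
  by [].
have argE : dotv (`|k| *: (sphere_proj (x + k^-1 *: n) `|k|^-1 x - (x + k^-1 *: n)))
    (`|k| *: (sphere_proj (x + k^-1 *: n) `|k|^-1 y - (x + k^-1 *: n))) = X.
  have projE c (r : R) (z : 'rV[R]_d.+1) :
      sphere_proj c r z - c = r *: ((enorm (z - c))^-1 *: (z - c)).
    by rewrite addrAC subrr add0r.
  rewrite !projE pE pE' enp enx xc !dotvE -pE' !dotvE nn -/b /X.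
  rewrite invfM !invrK; move: (Num.sqrt Q)^-1 => q.
  transitivity (`|k| ^+ 2 * - k^-1 * q * (b - k^-1)).
    by field; rewrite k_neq0.
  by rewrite k2; field.
have QE : Q = (1 - k * b) ^+ 2 + k ^+ 2 * (ww - b ^+ 2) by rewrite /Q; ring.
have kwb_ge0 : 0 <= k ^+ 2 * (ww - b ^+ 2) by rewrite mulr_ge0 ?sqr_ge0 ?subr_ge0.
have X2E : X ^+ 2 = (1 - k * b) ^+ 2 / Q by rewrite exprMn exprVn sqr_sqrtr.
have X2_le : X ^+ 2 <= 1.
  rewrite X2E; have [->|Q_neq0] := eqVneq Q 0; first by rewrite invr0 mulr0.
  by rewrite ler_pdivrMr ?lt_def ?Q_neq0// mul1r QE lerDl.
have XI : -1 <= X <= 1.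
  by rewrite -ler_norml -(@ler_pXn2r _ 2)// ?nnegrE// real_normK ?num_real// expr1n.
exists (acos X); split.
- by rewrite /sphere_dist invrK argE.
- by rewrite acos_ge0 ?acos_lepi.
- move=> kb_le1; rewrite leNgt; apply/negP => hlt.
  have pi_gt0 := pi_gt0 R.
  have : cos (acos X) < cos (pi / 2).
    rewrite ltr_cos// in_itv/= ?acos_ge0 ?acos_lepi//.
    by apply/andP; split; lra.
  rewrite acosK ?in_itv// cos_pihalf ltNge => /negP; apply.
  by rewrite divr_ge0 ?sqrtr_ge0// subr_ge0.
- rewrite sin_acos// sqr_sqrtr ?subr_ge0// -/Q.
  rewrite X2E; have [Q0|Q_neq0] := eqVneq Q 0; last first.
    by rewrite mulrBr mulr1 mulrC divfK// QE addrC addKr.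
  rewrite Q0 mul0r; apply/esym/eqP; move/esym/eqP: QE.
  by rewrite Q0 paddr_eq0 ?sqr_ge0// => /andP[].
Qed.

(** * Expansion of the sine *)

Lemma sin_expansion {R : realType} :
  unifO [set: unit] 5 (fun _ (t : R) => sin t - t + t ^+ 3 / 6).
Proof.
have near0 P : (forall t : R, P t) -> uniformly_near0 [set: unit] (fun _ t => P t).
  by exists 1.
have cos0O : unifO [set: unit] 0 (fun _ (t : R) => cos t).
  by apply: (@unifO_bounded _ _ _ 1) => _ t _; exact: cos_max.
have sin1O : unifO [set: unit] 1 (fun _ (t : R) => - sin t).
  apply: unifON; apply: unifO_primitive cos0O; first by rewrite sin0.
  by apply: near0 => t; exact: is_derive_sin.
have cos2O : unifO [set: unit] 2 (fun _ (t : R) => cos t - 1).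
  apply: unifO_primitive sin1O; first by rewrite cos0 subrr.
  apply: near0 => t.
  by rewrite -[X in is_derive _ _ _ X]subr0; exact: is_deriveB.
have sin3O : unifO [set: unit] 3 (fun _ (t : R) => - (sin t - t)).
  apply: unifON; apply: unifO_primitive cos2O; first by rewrite sin0 subrr.
  by apply: near0 => t; exact: is_deriveB.
have cos4O : unifO [set: unit] 4 (fun _ (t : R) => cos t - 1 + t ^+ 2 / 2).
  apply: unifO_primitive sin3O; first by rewrite cos0 expr0n/= mul0r subrr addr0.
  apply: near0 => t.
  have -> : (fun t : R => cos t - 1 + t ^+ 2 / 2) = cos - cst 1 + 2^-1 \*: id ^+ 2.
    by apply/funext => u; rewrite !fctE/= scalerRE mulrC.
  by apply: is_derive_eq; rewrite !scalerRE; field.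
apply: unifO_primitive cos4O; first by rewrite sin0 expr0n/= mul0r subrr addr0.
apply: near0 => t.
have -> : (fun t : R => sin t - t + t ^+ 3 / 6) = sin - id + 6^-1 \*: id ^+ 3.
  by apply/funext => u; rewrite !fctE/= scalerRE mulrC.
by apply: is_derive_eq; rewrite !scalerRE; field.
Qed.

(** Here tau = k t + k A t^3 is the candidate for the angle, and the first
   conjunct keeps it in the domain t >= 0 of the expansion of the sine. *)
Lemma sin_sqr_expansion {R : realType} {I : Type} (V : set I) (k : R)
    (A : I -> R) :
  0 < k -> unifO V 0 (fun v _ => A v) ->
  uniformly_near0 V (fun v t => k / 2 * t <= k * t + k * A v * t ^+ 3) /\
  unifO V 5 (fun v t => sin (k * t + k * A v * t ^+ 3) ^+ 2
    - (k ^+ 2 * t ^+ 2 + (2 * k ^+ 2 * A v - k ^+ 4 / 3) * t ^+ 4)).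
Proof.
move=> k_gt0 A0; pose tau v t := k * t + k * A v * t ^+ 3.
have cO (c : R) : unifO V 0 (fun _ _ => c) by exact: unifO_cst.
have tau_ge : uniformly_near0 V (fun v t => k / 2 * t <= tau v t).
  have At2 : unifO V 1 (fun v t => A v * t ^+ 2).
    by apply: (@unifO_lower _ _ _ 1 2) => //; apply: unifOMl => //; exact: unifO_X.
  have half_gt0 : 0 < 2^-1 :> R by rewrite invr_gt0.
  apply: uniformly_near0_imply (unifO1_lt half_gt0 At2) => v t _ t_ge0.
  rewrite ltr_norml => /andP[At2_ge _].
  have -> : tau v t = (k * t) * (1 + A v * t ^+ 2) by rewrite /tau; ring.
  by rewrite mulrAC ler_wpM2l ?mulr_ge0 ?(ltW k_gt0)//; lra.
split => //.
have tau1 : unifO V 1 tau.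
  apply: unifOD; first by apply: unifOMl => //; exact: unifO_X 1.
  apply: (@unifO_lower _ _ _ 1 3) => //; apply: unifOMl; last exact: unifO_X.
  exact: unifOMl.
have tau_ge0 : uniformly_near0 V (fun v t => 0 <= tau v t).
  apply: uniformly_near0_imply tau_ge => v t _ t_ge0; apply: le_trans.
  by rewrite mulr_ge0// divr_ge0// (ltW k_gt0).
have sinO := unifO_comp sin_expansion tau1 tau_ge0.
(* m is the coefficient of t^3 in sin tau. *)
pose m v := k * A v - k ^+ 3 / 6.
have m0 : unifO V 0 (fun v _ => m v).
  by apply: unifOB => //; exact: unifOMl.
pose e v t := sin (tau v t) - k * t - m v * t ^+ 3.
have tO j : unifO V j (fun _ t => t ^+ j) := unifO_X V j.
have e5 : unifO V 5 e.
  apply: (@unifO_ext _ _ _ _ (fun v t => (sin (tau v t) - tau v t + tau v t ^+ 3 / 6)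
     - k ^+ 3 / 6 * ((3 * A v + (3 * (A v * A v)) * t ^+ 2
        + (A v * (A v * A v)) * t ^+ 4) * t ^+ 5))).
    apply: unifOB => //; apply: unifOMl => //; apply: unifOMl => //.
    apply: unifOD; first apply: unifOD.
    - exact: unifOMl.
    - apply: (@unifO_lower _ _ _ 0 2) => //.
      by apply: unifOMl => //; apply: unifOMl => //; exact: unifOMl.
    - apply: (@unifO_lower _ _ _ 0 4) => //.
      by apply: unifOMl => //; apply: unifOMl => //; exact: unifOMl.
  by move=> v t _; rewrite /e /m /tau; field.
apply: (@unifO_ext _ _ _ _ (fun v t => m v * m v * t ^+ 6
   + (2 * (k * t ^+ 1 + m v * t ^+ 3) + e v t) * e v t)).
  apply: unifOD.
    apply: (@unifO_lower _ _ _ 5 6) => //; apply: unifOMl => //; exact: unifOMl.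
  apply: unifOMl => //; apply: unifOD; last exact: unifO_lower e5.
  apply: unifOMl => //; apply: unifOD.
    by apply: (@unifO_lower _ _ _ 0 1) => //; exact: unifOMl.
  by apply: (@unifO_lower _ _ _ 0 3) => //; exact: unifOMl.
move=> v t _; rewrite -/(tau v t).
have -> : sin (tau v t) = k * t + m v * t ^+ 3 + e v t by rewrite /e; ring.
by rewrite /m; field.
Qed.

(** * Expansion of the spherical distance *)

Section SphericalDistance.
Context {R : realType} {d : nat} (M : set 'rV[R]_d.+1) (x n : 'rV[R]_d.+1).
Context (hM : smooth_hypersurface M) (hx : M x) (hn : unit_normal M x n).
Context (k0 : R) (k0_neq0 : k0 != 0).
Let V := unit_geodesics M x.
Local Notation kappa := (curvature_at0 n).
Local Notation dist_from_x := (sphere_dist (x + k0^-1 *: n) `|k0|^-1 x).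

(** The coefficient of s^3 in d_S - s along a geodesic of normal curvature k.
   Its two roots k0 and 2 k0 are the exceptional curvatures of the theorem, and
   near k0 it is of the size of k - k0. *)
Definition cubic_coef (k : R) : R := - ((k - k0) * (k - 2 * k0)) / 6.

Lemma unifO_cubic_coef : unifO V 0 (fun g _ => cubic_coef (kappa g)).
Proof.
have cO (c : R) : unifO V 0 (fun _ _ => c) by exact: unifO_cst.
have kO := unifO_curvature n hM hx.
have kB c : unifO V 0 (fun g _ => kappa g - c) by exact: unifOB.
by apply: unifOMl (cO _); apply: unifON; apply: unifOMl.
Qed.

(** Let theta be the central angle, so that dist_from_x = theta / |k0|, and let
   tau = |k0| (t + A t^3) with A the cubic coefficient. By the expansions of
   the chord and of the normal coordinate, sin^2 theta - sin^2 tau = O(t^5): A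
   is the value that makes the terms in t^4 cancel. Since the difference of the
   squared sines dominates (theta + tau) |theta - tau| and tau is of exact
   order t, dividing by t leaves theta - tau = O(t^4). *)
Lemma sphere_dist_expansion :
  unifO V 4 (fun g t => dist_from_x (g t) - t - cubic_coef (kappa g) * t ^+ 3).
Proof.
pose K := `|k0|; have K_gt0 : 0 < K by rewrite normr_gt0.
have K2 : K ^+ 2 = k0 ^+ 2 by rewrite real_normK ?num_real.
pose A (g : R -> 'rV[R]_d.+1) := cubic_coef (kappa g).
have cO (c : R) : unifO V 0 (fun _ _ => c) := unifO_cst V c.
have tO j : unifO V j (fun _ (t : R) => t ^+ j) := unifO_X V j.
have kO : unifO V 0 (fun g _ => kappa g) := unifO_curvature n hM hx.
have AO : unifO V 0 (fun g _ => A g) := unifO_cubic_coef.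
have [tau_ge tau_sin] := sin_sqr_expansion K_gt0 AO.
pose tau (g : R -> 'rV[R]_d.+1) (t : R) := K * t + K * A g * t ^+ 3.
pose theta (g : R -> 'rV[R]_d.+1) (t : R) := K * dist_from_x (g t).
pose b (g : R -> 'rV[R]_d.+1) (t : R) := dotv n (g t - x).
pose ww (g : R -> 'rV[R]_d.+1) (t : R) := dotv (g t - x) (g t - x).
pose Q (g : R -> 'rV[R]_d.+1) (t : R) := 1 - 2 * (k0 * b g t) + k0 ^+ 2 * ww g t.
have thetaP (g : R -> 'rV[R]_d.+1) (t : R) : [/\ 0 <= theta g t <= pi, k0 * b g t <= 1 -> theta g t <= pi / 2
    & Q g t * sin (theta g t) ^+ 2 = k0 ^+ 2 * (ww g t - b g t ^+ 2)].
  have [th [thE ? ? ?]] := sphere_dist_angle x (g t) (dotv_normal_self hn) k0_neq0.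
  by rewrite /theta thE mulVKf// gt_eqF.
have bO : unifO V 3 (fun g t => b g t - kappa g / 2 * t ^+ 2) := normal_expansion hM hx hn.
have wO : unifO V 5 (fun g t => ww g t - t ^+ 2 + kappa g ^+ 2 / 12 * t ^+ 4) :=
  chord_expansion hM hx hn.
have b2O : unifO V 2 (fun g t => b g t).
  apply: (@unifO_ext _ _ _ _
    (fun g t => (b g t - kappa g / 2 * t ^+ 2) + kappa g / 2 * t ^+ 2)).
    apply: unifOD; first exact: unifO_lower bO.
    by apply: unifOMl => //; exact: unifOMl.
  by move=> g t _; ring.
have k2O : unifO V 0 (fun g _ => kappa g ^+ 2) by exact: unifOMl.
have w2O : unifO V 4 (fun g t => ww g t - t ^+ 2).
  apply: (@unifO_ext _ _ _ _
    (fun g t => (ww g t - t ^+ 2 + kappa g ^+ 2 / 12 * t ^+ 4)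
      - kappa g ^+ 2 / 12 * t ^+ 4)).
    apply: unifOB; first exact: unifO_lower wO.
    by apply: unifOMl => //; exact: unifOMl.
  by move=> g t _; ring.
pose q (g : R -> 'rV[R]_d.+1) (t : R) := - 2 * (k0 * (b g t - kappa g / 2 * t ^+ 2)) + k0 ^+ 2 * (ww g t - t ^+ 2).
have qO : unifO V 3 q.
  apply: unifOD; first by apply: unifOMl => //; exact: unifOMl.
  by apply: unifOMl => //; exact: unifO_lower w2O.
have QE g t : Q g t = 1 + (k0 ^+ 2 - k0 * kappa g) * t ^+ 2 + q g t.
  by rewrite /Q /q; field.
have k01O : unifO V 0 (fun g _ => k0 ^+ 2 - k0 * kappa g).
  by apply: unifOB => //; exact: unifOMl.
have Q1O : unifO V 1 (fun g t => Q g t - 1).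
  apply: (@unifO_ext _ _ _ _ (fun g t => (k0 ^+ 2 - k0 * kappa g) * t ^+ 2 + q g t)).
    apply: unifOD; last exact: unifO_lower qO.
    by apply: (@unifO_lower _ _ _ 1 2) => //; exact: unifOMl.
  by move=> g t _; rewrite QE; ring.
have half_gt0 : 0 < 2^-1 :> R by rewrite invr_gt0.
have Q_ge : uniformly_near0 V (fun g t => 2^-1 <= Q g t).
  apply: uniformly_near0_imply (unifO1_lt half_gt0 Q1O) => g t _ _.
  by rewrite ltr_norml => /andP[? _]; lra.
have QO : unifO V 0 Q.
  apply: (@unifO_ext _ _ _ _ (fun g t => 1 + (Q g t - 1))).
    by apply: unifOD => //; exact: unifO_lower Q1O.
  by move=> g t _; ring.
pose m (g : R -> 'rV[R]_d.+1) := 2 * k0 ^+ 2 * A g - k0 ^+ 4 / 3.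
have mO : unifO V 0 (fun g _ => m g) by apply: unifOB => //; exact: unifOMl.
pose es (g : R -> 'rV[R]_d.+1) (t : R) := sin (tau g t) ^+ 2 - (k0 ^+ 2 * t ^+ 2 + m g * t ^+ 4).
have esO : unifO V 5 es.
  move: tau_sin; rewrite (exprM K 2 2) K2 -(exprM k0 2 2).
  exact.
(* Multiplying by Q, which is close to 1, avoids expanding a quotient. *)
have QdiffO : unifO V 5 (fun g t =>
    Q g t * (sin (theta g t) ^+ 2 - sin (tau g t) ^+ 2)).
  apply: (@unifO_ext _ _ _ _ (fun g t =>
    k0 ^+ 2 * ((ww g t - t ^+ 2 + kappa g ^+ 2 / 12 * t ^+ 4)
       - kappa g * (t ^+ 2 * (b g t - kappa g / 2 * t ^+ 2))
       - (b g t - kappa g / 2 * t ^+ 2) * (b g t - kappa g / 2 * t ^+ 2))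
    - (k0 ^+ 2 - k0 * kappa g) * (m g * t ^+ 6) - Q g t * es g t
    - t ^+ 2 * ((k0 ^+ 2 + m g * t ^+ 2) * q g t))).
    apply: unifOB; last first.
      apply: (@unifOM _ _ _ 2 3) => //; apply: unifOMl => //.
      by apply: unifOD => //; apply: (@unifO_lower _ _ _ 0 2) => //; exact: unifOMl.
    apply: unifOB; last exact: unifOMl.
    apply: unifOB; last first.
      apply: unifOMl => //; apply: (@unifO_lower _ _ _ 5 6) => //; exact: unifOMl.
    apply: unifOMl => //; apply: unifOB; last first.
      by apply: (@unifO_lower _ _ _ 5 6) => //; exact: (@unifOM _ _ _ 3 3).
    apply: unifOB => //; apply: unifOMl => //.
    exact: (@unifOM _ _ _ 2 3).
  move=> g t _; have [_ _ thE] := thetaP g t.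
  rewrite mulrBr thE.
  have -> : sin (tau g t) ^+ 2 = k0 ^+ 2 * t ^+ 2 + m g * t ^+ 4 + es g t.
    by rewrite /es; ring.
  by rewrite [Q g t in RHS]QE [Q g t in LHS]QE /m /A /cubic_coef; field.
have [B B_ge0 diffB] := unifO_ge0 QdiffO.
pose c := cos (pi / 3 : R) ^+ 4.
have pi_gt0 := pi_gt0 R.
have c_gt0 : 0 < c by rewrite exprn_gt0// cos_gt0_pihalf//; apply/andP; split; lra.
have tau1O : unifO V 1 tau.
  apply: unifOD; first by apply: unifOMl => //; exact: tO 1%N.
  apply: (@unifO_lower _ _ _ 1 3) => //; apply: unifOMl => //; exact: unifOMl.
have kb1O : unifO V 1 (fun g t => k0 * b g t).
  by apply: unifOMl => //; exact: unifO_lower b2O.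
have pi6_gt0 : 0 < pi / 6 :> R by rewrite divr_gt0.
have angleO : unifO V 4 (fun g t => theta g t - tau g t).
  exists (4 * B / (c * K)).
  have := uniformly_near0_and (uniformly_near0_and diffB Q_ge)
    (uniformly_near0_and (unifO1_lt pi6_gt0 tau1O)
      (uniformly_near0_and (unifO1_lt ltr01 kb1O) tau_ge)).
  apply: uniformly_near0_imply => g t _ t_ge0 [[dB Qge] [tau_lt [kb_lt tau_ge_t]]].
  rewrite -/(tau g t) in tau_ge_t.
  have [/andP[th_ge0 _] th_le _] := thetaP g t.
  have {}th_le : theta g t <= pi / 2 by apply/th_le/ltW/(le_lt_trans (ler_norm _) kb_lt).
  have tau_ge0 : 0 <= tau g t.
    by apply: le_trans tau_ge_t; rewrite mulr_ge0// divr_ge0// ltW.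
  have tau_le : tau g t <= pi / 6 by apply/ltW/(le_lt_trans (ler_norm _) tau_lt).
  have cmp := @angle_diff_le_sin_sqr _ (theta g t) (tau g t).
  rewrite th_ge0 tau_ge0 th_le tau_le -/c in cmp; have {}cmp := cmp isT isT.
  set D := `|theta g t - tau g t| in cmp *.
  have D_ge0 : 0 <= D := normr_ge0 _.
  have sin_le : `|sin (theta g t) ^+ 2 - sin (tau g t) ^+ 2| <= 2 * B * t ^+ 5.
    move: dB; rewrite normrM (ger0_norm (le_trans (ltW half_gt0) Qge)) => dB.
    have := normr_ge0 (sin (theta g t) ^+ 2 - sin (tau g t) ^+ 2); nra.
  have {}cmp := le_trans cmp sin_le.
  (* At t = 0 there is no power of t to divide by; there tau = 0 and the
     comparison forces theta = 0. *)
  move: t_ge0; rewrite le_eqVlt => /predU1P[t0|t_gt0].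
    have rhs0 : 2 * B * t ^+ 5 = 0 by rewrite -t0 expr0n/= mulr0.
    rewrite rhs0 in cmp.
    have D_le : D <= theta g t + tau g t.
      by rewrite /D ler_norml; apply/andP; split; lra.
    suff D0 : D = 0 by rewrite D0 -t0 expr0n/= mulr0.
    apply/eqP; rewrite -sqrf_eq0 eq_le sqr_ge0 andbT expr2.
    rewrite -(pmulr_rle0 _ c_gt0); apply: le_trans cmp.
    by rewrite ler_pM2l// ler_wpM2r.
  have : c * (K / 2 * t * D) <= 2 * B * t ^+ 5.
    apply: le_trans cmp; rewrite ler_pM2l// ler_wpM2r//.
    by apply: (le_trans tau_ge_t); rewrite lerDr.
  have -> : 2 * B * t ^+ 5 = (2 * B * t ^+ 4) * t by ring.
  have -> : c * (K / 2 * t * D) = (c * K * D / 2) * t by ring.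
  rewrite ler_pM2r// => bound.
  rewrite [leRHS]mulrAC ler_pdivlMr; last exact: mulr_gt0.
  by lra.
apply: (@unifO_ext _ _ _ _ (fun g t => K^-1 * (theta g t - tau g t))).
  exact: unifOMl.
move=> g t _; rewrite /theta /tau -/(A g).
by field; rewrite gt_eqF.
Qed.

End SphericalDistance.

(** * The spherical distance approximates the geodesic distance *)

Lemma geodesic_dist_ge0 {R : realType} {d : nat} (M : set 'rV[R]_d.+1) p q :
  (0 <= geodesic_dist M p q)%E.
Proof.
apply/ereal_infP => _ [g _ <-].
by apply: integral_ge0 => t _; rewrite lee_fin sqrtr_ge0.
Qed.

Lemma exponential_ray_unit_geodesic {R : realType} {d : nat}
    (M : set 'rV[R]_d.+1) (x v : 'rV[R]_d.+1) e :
  is_exponential_map M x e -> unit_tangent M x v ->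
  unit_geodesics M x (fun t => e (t *: v)).
Proof.
move=> he [tv v1]; have [g [hg g0 dg eg]] := he _ tv.
have -> : (fun t => e (t *: v)) = g by apply/funext.
by split; rewrite ?dg.
Qed.

Lemma normal_curvatureE {R : realType} {d : nat} (M : set 'rV[R]_d.+1)
    (x n v : 'rV[R]_d.+1) e :
  smooth_hypersurface M -> M x -> unit_normal M x n ->
  is_exponential_map M x e -> unit_tangent M x v ->
  normal_curvature e n v = curvature_at0 n (fun t => e (t *: v)).
Proof.
move=> hM hx hn he hv.
have acc0 := acceleration_at0 hM hx hn (exponential_ray_unit_geodesic he hv).
have getE : derive1n 2 (fun s : R => e (s *: v)) 0 = normal_curvature e n v *: n.
  apply: (@getPex _ [set k : R | derive1n 2 (fun s : R => e (s *: v)) 0 = k *: n]).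
  by exists (curvature_at0 n (fun t => e (t *: v))).
by rewrite /curvature_at0 getE dotvZr (dotv_normal_self hn) mulr1.
Qed.

Lemma sphere_dist_bounds {R : realType} {d : nat} (x n y : 'rV[R]_d.+1) (k : R) :
  dotv n n = 1 -> k != 0 ->
  0 <= sphere_dist (x + k^-1 *: n) `|k|^-1 x y <= `|k|^-1 * pi.
Proof.
move=> nn k_neq0; have [th [-> /andP[th_ge0 th_le] _ _]] :=
  sphere_dist_angle x y nn k_neq0.
by rewrite mulr_ge0//= ler_wpM2l.
Qed.

Theorem corollary1 (R : realType) (d : nat) (M : set 'rV[R]_d.+1)
  (hM : smooth_hypersurface M) (cM : compact M)
  (x : 'rV[R]_d.+1) (hx : M x)
  (n : 'rV[R]_d.+1) (hn : unit_normal M x n)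
  (expx : 'rV[R]_d.+1 -> 'rV[R]_d.+1) (hexp : is_exponential_map M x expx)
  (kappa0 : R)
  (hkappa0 : kappa_min M x expx n <= kappa0 <= kappa_max M x expx n)
  (kappa0_neq0 : kappa0 != 0) :
  let c := x + kappa0^-1 *: n in
  let r := `|kappa0|^-1 in
  (exists C rho0 : R, 0 < rho0 /\
     forall (v : 'rV[R]_d.+1) (s : R) (y : 'rV[R]_d.+1),
       unit_tangent M x v ->
       y = expx (s *: v) ->
       geodesic_ball M x rho0 y ->
       geodesic_dist M x y = s%:E ->
       let kappay := normal_curvature expx n v in
       kappay = kappa0 \/ kappay = 2 * kappa0 ->
       `|sphere_dist c r x y - s| <= C * s ^+ 4)
  /\
  (exists C : R,
     forall rbar : R, 0 < rbar ->
       (forall z, geodesic_ball M x rbar z -> z != c) ->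
       `|kappa_max M x expx n - kappa_min M x expx n| < rbar ->
     forall (v : 'rV[R]_d.+1) (s : R) (y : 'rV[R]_d.+1),
       unit_tangent M x v ->
       y = expx (s *: v) ->
       geodesic_ball M x rbar y ->
       geodesic_dist M x y = s%:E ->
       `|sphere_dist c r x y - s| <= C * (rbar * s ^+ 3)).
Proof.
move=> c r.
have [C4 C4_ge0 [s0 s0_gt0 expansion]] :=
  unifO_ge0 (sphere_dist_expansion hM hx hn kappa0_neq0).
have {}expansion v s y : unit_tangent M x v -> y = expx (s *: v) -> 0 <= s <= s0 ->
    `|sphere_dist c r x y - s
      - cubic_coef kappa0 (normal_curvature expx n v) * s ^+ 3| <= C4 * s ^+ 4.
  move=> hv -> hs; rewrite (normal_curvatureE hM hx hn hexp hv).
  exact: (expansion _ s (exponential_ray_unit_geodesic hexp hv) hs).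
have s_ge0 s y : geodesic_dist M x y = s%:E -> 0 <= s.
  by move=> sE; rewrite -lee_fin -sE geodesic_dist_ge0.
have s_lt rho s y : geodesic_ball M x rho y -> geodesic_dist M x y = s%:E -> s < rho.
  by move=> [_ +] sE; rewrite sE lte_fin.
split.
  exists C4, s0; split => // v s y hv yE ys sE kappay hk.
  have := expansion v s y hv yE; rewrite (s_ge0 _ _ sE) (ltW (s_lt _ _ _ ys sE)).
  suff -> : cubic_coef kappa0 (normal_curvature expx n v) = 0.
    by rewrite mul0r subr0; apply.
  by rewrite /cubic_coef -/kappay; case: hk => ->; rewrite subrr ?mul0r ?mulr0 oppr0 mul0r.
have [B B_ge0 [e e_gt0 kappa_bound]] := unifO_ge0 (unifO_curvature n hM hx).
have {}kappa_bound v : unit_tangent M x v -> `|normal_curvature expx n v| <= B.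
  move=> hv; rewrite (normal_curvatureE hM hx hn hexp hv).
  have := kappa_bound _ 0 (exponential_ray_unit_geodesic hexp hv).
  by rewrite lexx (ltW e_gt0) expr0 mulr1; apply.
have kappa_range v : unit_tangent M x v ->
    kappa_min M x expx n <= normal_curvature expx n v <= kappa_max M x expx n.
  move=> hv; apply/andP; split.
    apply: inf_lbound; last by exists v.
    exists (- B) => _ [w hw <-].
    by have := kappa_bound w hw; rewrite ler_norml => /andP[].
  apply: sup_ubound; last by exists v.
  exists B => _ [w hw <-].
  by have := kappa_bound w hw; rewrite ler_norml => /andP[].
(* L bounds the cubic coefficient by L * rbar. The term far takes care of
   s > s0, where the trivial bound r pi + s is absorbed by s^4 and s < rbar. *)
pose L := (B + 2 * `|kappa0|) / 6.
pose far := r * pi / s0 ^+ 4 + (s0 ^+ 3)^-1.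
have pi_ge0 := pi_ge0 R.
have r_ge0 : 0 <= r by rewrite invr_ge0.
have L_ge0 : 0 <= L by rewrite divr_ge0// addr_ge0// mulr_ge0.
have far_ge0 : 0 <= far.
  by rewrite addr_ge0 ?invr_ge0 ?divr_ge0 ?mulr_ge0 ?exprn_ge0// ltW.
exists (C4 + L + far) => rbar rbar_gt0 _ kappa_close v s y hv yE ys sE.
have s_nneg := s_ge0 _ _ sE; have s_rbar := ltW (s_lt _ _ _ ys sE).
have s3_ge0 : 0 <= s ^+ 3 by rewrite exprn_ge0.
have s4_le : s ^+ 4 <= rbar * s ^+ 3 by rewrite exprS ler_wpM2r.
have [s_le|s_gt] := leP s s0.
  have := expansion v s y hv yE; rewrite s_nneg s_le => /(_ isT) near_bound.
  have coef_le : `|cubic_coef kappa0 (normal_curvature expx n v)| <= L * rbar.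
    have diff_le : `|normal_curvature expx n v - kappa0| <= rbar.
      have /andP[k_ge k_le] := kappa_range _ hv; have /andP[k0_ge k0_le] := hkappa0.
      have kk := le_lt_trans (ler_norm _) kappa_close.
      by rewrite ler_norml; apply/andP; split; lra.
    have sum_le : `|normal_curvature expx n v - 2 * kappa0| <= B + 2 * `|kappa0|.
      apply: (le_trans (ler_normB _ _)); rewrite normrM [`|2|]ger0_norm//.
      by rewrite lerD2r kappa_bound.
    have prod_le := ler_pM (normr_ge0 _) (normr_ge0 _) diff_le sum_le.
    rewrite /cubic_coef normrM normrN normrM [`|6^-1|]ger0_norm//.
    by rewrite /L; lra.
  have triangle := ler_normD (sphere_dist c r x y - s
    - cubic_coef kappa0 (normal_curvature expx n v) * s ^+ 3)
    (cubic_coef kappa0 (normal_curvature expx n v) * s ^+ 3).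
  rewrite subrK normrM (ger0_norm s3_ge0) in triangle.
  have C4_le := ler_wpM2l C4_ge0 s4_le.
  have coef_s3_le := ler_wpM2r s3_ge0 coef_le.
  have far_term : 0 <= far * (rbar * s ^+ 3).
    by rewrite mulr_ge0// mulr_ge0// ltW.
  by lra.
have /andP[sd_ge0 sd_le] := sphere_dist_bounds x y (dotv_normal_self hn) kappa0_neq0.
rewrite -/c -/r in sd_ge0 sd_le.
have far_ge : r * pi + s <= far * s ^+ 4.
  rewrite /far mulrDl; apply: lerD.
    rewrite mulrAC ler_pdivlMr ?exprn_gt0// ler_wpM2l ?mulr_ge0//.
    by rewrite lerXn2r ?nnegrE// ltW.
  rewrite mulrC ler_pdivlMr ?exprn_gt0// [s ^+ 4]exprS ler_wpM2l//.
  by rewrite lerXn2r ?nnegrE// ltW.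
have rest_ge0 : 0 <= (C4 + L) * (rbar * s ^+ 3).
  by rewrite mulr_ge0 ?addr_ge0// mulr_ge0// ltW.
have far_le := ler_wpM2l far_ge0 s4_le.
by rewrite ler_norml; apply/andP; split; lra.
Qed.
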